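(* Let $\mathcal{D}$ be a finite set. Then $\mathcal{B}r(\mathcal{D})$, the free brace algebra generated by $\mathcal{D}$, endowed with the pre-Lie product $\langle -;-\rangle$ (its binary brace operation), is a free pre-Lie algebra.
   Context: $K$ is a field of characteristic zero; all vector spaces and algebras are over $K$. A (left) pre-Lie algebra is a vector space $A$ with a bilinear product $\circ$ such that $(x\circ y)\circ z-x\circ(y\circ z)=(y\circ x)\circ z-y\circ(x\circ z)$ for all $x,y,z\in A$. A pre-Lie algebra is free if it is isomorphic to the free pre-Lie algebra generated by some set (equivalently, by some vector space). Trees: $\mathcal{T}_P^{\mathcal{D}}$ is the set of planar rooted trees (finite, nonempty) whose vertices are decorated by elements of $\mathcal{D}$. For $d\in\mathcal{D}$ and $t_1,\ldots,t_n\in\mathcal{T}_P^{\mathcal{D}}$ ($n\ge 0$), $B_d(t_1\ldots t_n)$ is the planar rooted tree obtained by grafting $t_1,\ldots,t_n$, in this order from left to right, on a common root decorated by $d$; $B_d(1)$ is the one-vertex tree decorated by $d$. The free brace algebra $\mathcal{B}r(\mathcal{D})$ generated by $\mathcal{D}$ is realized as the vector space $K\mathcal{T}_P^{\mathcal{D}}$ with basis $\mathcal{T}_P^{\mathcal{D}}$, with brace operations $\langle t_1,\ldots,t_{n-1};t_n\rangle$ equal to the sum of all planar graftings of the ordered forest $t_1\ldots t_{n-1}$ over $t_n$. Its binary operation $\langle -;-\rangle$ is a pre-Lie product, determined bilinearly and inductively by: $\langle t;B_d(1)\rangle=B_d(t)$ and $$\langle t;B_d(t_1\ldots t_n)\rangle=\sum_{i=0}^n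 B_d(t_1\ldots t_i\,t\,t_{i+1}\ldots t_n)+\sum_{i=1}^n B_d(t_1\ldots t_{i-1}\langle t;t_i\rangle t_{i+1}\ldots t_n)$$ for $t,t_1,\ldots,t_n\in\mathcal{T}_P^{\mathcal{D}}$, $d\in\mathcal{D}$. *)

(* Defs.v *)
From HB Require Import structures.
From mathcomp Require Import all_boot all_algebra.
From mathcomp Require Import finmap.
From mathcomp Require Import monalg.

Set Implicit Arguments.
Unset Strict Implicit.
Unset Printing Implicit Defensive.

Import GRing.Theory.
Local Open Scope ring_scope.

(* [Bnode d [:: t1; ...; tn]] is B_d(t1 ... tn); the children are ordered. *)
Inductive ptree (D : Type) : Type := Bnode of D & seq (ptree D).

Section PtreeChoice.
Variable D : Type.

Fixpoint ptree_encode (t : ptree D) : GenTree.tree D :=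
  let: Bnode d ts := t in
  GenTree.Node 0 (GenTree.Leaf d :: map ptree_encode ts).

Fixpoint ptree_decode (g : GenTree.tree D) : option (ptree D) :=
  match g with
  | GenTree.Node _ (GenTree.Leaf d :: gs) =>
      Some (Bnode d (pmap ptree_decode gs))
  | _ => None
  end.

Lemma ptree_encodeK : pcancel ptree_encode ptree_decode.
Proof.
rewrite /pcancel; fix IH 1; case=> d ts /=; congr (Some (Bnode d _)).
by elim: ts => //= t ts ->; rewrite IH.
Qed.
End PtreeChoice.

HB.instance Definition _ (D : choiceType) :=
  Choice.copy (ptree D) (pcan_type (@ptree_encodeK D)).

Section LinearExtension.
Variables (K : fieldType) (T : choiceType) (V : lmodType K).

(* The linear extension to K T of a map defined on the basis T. *)
Definition malg_lift (f : T -> V) (x : {malg K[T]}) : V :=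
  \sum_(t <- msupp x) x@_t *: f t.

Lemma malg_lift_sup (f : T -> V) (x : {malg K[T]}) (E : {fset T}) :
  {subset msupp x <= E} -> malg_lift f x = \sum_(t <- E) x@_t *: f t.
Proof.
move=> sxE; rewrite /malg_lift.
apply: big_fset_incl => [|t _ /mcoeff_outdom->]; first exact/fsubsetP.
by rewrite scale0r.
Qed.

Lemma malg_lift_linear (f : T -> V) : linear (malg_lift f).
Proof.
move=> a x y; pose E := (msupp (a *: x + y) `|` (msupp x `|` msupp y))%fset.
rewrite (@malg_lift_sup f _ E) => [|t]; last by rewrite !in_fsetU => ->.
rewrite (@malg_lift_sup f x E) => [|t]; last first.
  by rewrite !in_fsetU => ->; rewrite !orbT.
rewrite (@malg_lift_sup f y E) => [|t]; last first.
  by rewrite !in_fsetU => ->; rewrite !orbT.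
rewrite scaler_sumr -big_split; apply: eq_bigr => t _ /=.
by rewrite mcoeffD mcoeffZ scalerDl scalerA.
Qed.

Lemma malg_lift_basis (f : T -> V) (t : T) : malg_lift f << t >> = f t.
Proof.
rewrite (@malg_lift_sup f _ [fset t]%fset) ?big_seq_fset1.
  by rewrite mcoeffUU scale1r.
by move=> u; apply: (fsubsetP (msuppU_le)).
Qed.
End LinearExtension.

Section FreeBrace.
Variables (K : fieldType) (D : choiceType).
Implicit Types (t u : ptree D) (ts us : seq (ptree D)).

(* The underlying vector space of Br(D). *)
Definition Br : lmodType K := {malg K[ptree D]}.

(* The list, with multiplicity, of the planar graftings of [t] over [u]: either
   [t] becomes a new child of the root, or it is grafted over one child. *)
Fixpoint graft t u : seq (ptree D) :=
  let fix graft_forest us : seq (seq (ptree D)) :=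
    match us with
    | [::] => [:: [:: t]]
    | v :: vs => (t :: v :: vs)
                   :: [seq w :: vs | w <- graft t v]
                   ++ [seq v :: ws | ws <- graft_forest vs]
    end in
  let: Bnode d us := u in map (Bnode d) (graft_forest us).

(* The binary brace < x ; y >. *)
Definition brace (x y : Br) : Br :=
  malg_lift (fun t => malg_lift (fun u => \sum_(v <- graft t u) << v >>) y) x.

Lemma brace_linearl (y : Br) : linear (brace^~ y).
Proof. exact: malg_lift_linear. Qed.

Lemma brace_linearr (x : Br) : linear (brace x).
Proof.
move=> a y z; rewrite /brace /malg_lift scaler_sumr -big_split /=.
apply: eq_bigr => t _; rewrite -!/(malg_lift _ _) malg_lift_linear.
by rewrite scalerDr !scalerA mulrC.
Qed.

Lemma brace_basis t u : brace << t >> << u >> = \sum_(v <- graft t u) << v >>.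
Proof. by rewrite /brace !malg_lift_basis. Qed.

Lemma brace_leaf t (d : D) :
  brace << t >> << Bnode d [::] >> = << Bnode d [:: t] >>.
Proof. by rewrite brace_basis big_seq1. Qed.

(* < t ; B_d(t_1 ... t_n) > = \sum_i B_d(t_1 ... t_i t t_(i+1) ... t_n)
     + \sum_i B_d(t_1 ... t_(i-1) < t ; t_i > t_(i+1) ... t_n);
   [malg_lift] expresses the linearity of B_d in its i-th argument. *)
Lemma brace_node t (d : D) ts :
  brace << t >> << Bnode d ts >> =
    \sum_(i < (size ts).+1) << Bnode d (take i ts ++ t :: drop i ts) >>
  + \sum_(i < size ts)
      malg_lift (fun w => << Bnode d (take i ts ++ w :: drop i.+1 ts) >>)
        (brace << t >> << nth t ts i >>) :> Br.
Proof.
rewrite brace_basis /=.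
set gf := (fix graft_forest us := _).
have liftE (f : ptree D -> Br) v :
    malg_lift f (brace << t >> << v >>) = \sum_(w <- graft t v) f w.
  rewrite brace_basis; elim: (graft t v) => [|w ws IH].
    by rewrite !big_nil /malg_lift msupp0 big_seq_fset0.
  rewrite !big_cons -IH -[X in malg_lift f (X + _)]scale1r malg_lift_linear.
  by rewrite scale1r malg_lift_basis.
rewrite big_map.
rewrite [X in _ = _ + X](eq_bigr _ (fun _ _ => liftE _ _)).
suff gen (F : seq (ptree D) -> Br) : \sum_(ws <- gf ts) F ws =
    \sum_(i < (size ts).+1) F (take i ts ++ t :: drop i ts)
  + \sum_(i < size ts) \sum_(w <- graft t (nth t ts i))
       F (take i ts ++ w :: drop i.+1 ts).
  exact: (gen (fun ws => << Bnode d ws >>)).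
elim: ts F => [|v vs IH] F.
  by rewrite big_ord0 big_ord1 /= big_seq1 addr0.
rewrite big_cons big_cat !big_map /= IH.
rewrite [in RHS]big_ord_recl /= [X in _ = _ + X]big_ord_recl /= drop0.
rewrite -!addrA; congr (_ + _).
by rewrite addrCA.
Qed.
End FreeBrace.

Section PreLie.
Variable K : fieldType.

Definition is_prelie (A : lmodType K) (op : A -> A -> A) : Prop :=
  [/\ forall y, linear (op^~ y),
      forall x, linear (op x)
    & forall x y z,
        op (op x y) z - op x (op y z) = op (op y x) z - op y (op x z)].

Definition is_prelie_morphism (A B : lmodType K)
    (opA : A -> A -> A) (opB : B -> B -> B) (phi : {linear A -> B}) : Prop :=
  forall x y, phi (opA x y) = opB (phi x) (phi y).

(* (A, op) with [iota : X -> A] is the free pre-Lie algebra on the set X. *)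
Definition is_free_prelie_on (X : Type) (A : lmodType K) (op : A -> A -> A)
    (iota : X -> A) : Prop :=
  is_prelie op /\
  forall (B : lmodType K) (opB : B -> B -> B), is_prelie opB ->
  forall f : X -> B,
  exists phi : {linear A -> B},
    [/\ is_prelie_morphism op opB phi,
        forall x, phi (iota x) = f x
      & forall psi : {linear A -> B}, is_prelie_morphism op opB psi ->
          (forall x, psi (iota x) = f x) -> psi =1 phi].

Definition is_free_prelie (A : lmodType K) (op : A -> A -> A) : Prop :=
  exists (X : Type) (iota : X -> A), is_free_prelie_on op iota.
End PreLie.

(* Main.v *)
From HB Require Import structures.
Require Import Defs.
From mathcomp Require Import all_boot all_algebra.
From mathcomp Require Import monalg zify.

Set Implicit Arguments.
Unset Strict Implicit.
Unset Printing Implicit Defensive.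

Import GRing.Theory.
Local Open Scope ring_scope.

(** The brace of two trees is a sum of trees with a leading term, and the
    leading term behaves like the product of a free permutative algebra; the
    freeness of the brace algebra is read off from this.

    Number the trees, so that the children of a root form a word over the
    natural numbers. Order trees by the number of vertices, then by the number
    of children of the root, then lexicographically by the word of children. In
    < s ; u > the graftings of s at the root of u have one child more than those
    inside a child of u, and the lexicographically largest place for s among the
    children of u is in front of the first child smaller than s. So the leading
    term [nap s u] is u with s inserted there, its coefficient is a positive
    integer, hence invertible, and the other terms are smaller ([graft_lead],
    [leading_coef_neq0]). Insertions commute, [nap s (nap s' w)] =
    [nap s' (nap s w)], and conversely two different factorizations of a tree
    always arise in this way ([nap_exchange]).

    The trees that are not of the form [nap s u] are the free generators. Given
    a map f from them to a pre-Lie algebra B, its extension is defined on trees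
    by recursion along the order: each other tree t is a leading term
    [nap s u] for one chosen pair (s, u), and solving the equation
    ext < s ; u > = ext s * ext u for ext t forces its value ([ext_basis]);
    this also gives uniqueness ([ext_unique]).

    It remains to see that ext < s ; u > = ext s * ext u for every pair, not
    only for the chosen ones ([ext_brace_basis]). By induction along the order,
    let (s', u') be the chosen pair with the same leading term t as (s, u). If
    they differ, then u = nap s' w and u' = nap s w, and < s ; < s' ; w > > is a
    nonzero multiple of < s ; u > plus terms with a smaller leading term. The
    pre-Lie identity
      < s ; < s' ; w > > = < < s ; s' > ; w > - < < s' ; s > ; w >
                            + < s' ; < s ; w > >
    holds on both sides of ext. Its first two terms are smaller than t, as their
    roots have one child less, and the last is a multiple of < s' ; u' >, where
    multiplicativity is the definition, plus smaller terms. *)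

(** * Words and the largest insertion of a letter *)

Section Words.
Variables (T : eqType) (key : T -> nat).
Hypothesis key_inj : injective key.
Implicit Types (x y : T) (s p q : seq T).

Fixpoint lexlt p q : bool :=
  match p, q with
  | x :: p', y :: q' => (key x < key y)%N || (x == y) && lexlt p' q'
  | _, _ => false
  end.

Definition shortlex p q : bool :=
  (size p < size q)%N || (size p == size q) && lexlt p q.

Lemma lexlt_wf : well_founded (fun p q => (size p == size q) && lexlt p q).
Proof.
move=> s; have [n] : {n | size s = n} by exists (size s).
elim: n s => [|n IHn] s.
  by move=> /size0nil->; constructor=> p; case: p => [|y p] /=.
case: s => [|x s]; [by [] | case].
have [k] := ubnP (key x); elim: k x s => [|k IHk] x s le_xk sz_s; [by [] |].
have acc_s := IHn _ sz_s; elim: acc_s sz_s => {}s _ IHs /= sz_s.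
constructor=> p.
case: p => [|y p]; [by [] | rewrite /= eqSS].
case/andP=> /eqP sz_p /orP[lt_yx|/andP[/eqP-> lt_ps]].
  by apply: IHk; [apply: leq_trans lt_yx _ | rewrite sz_p].
by apply: IHs; rewrite ?sz_p ?eqxx.
Qed.

(** The length comes first because the lexicographic order alone is not well
    founded on words of unbounded length. *)
Lemma shortlex_wf : well_founded shortlex.
Proof.
move=> s; have [n] := ubnP (size s).
elim: n s => [|n IHn] s le_sn; [by [] |].
elim: (lexlt_wf s) le_sn => {}s _ IHs le_sn; constructor=> p.
case/orP=> [lt_ps|/andP[/eqP sz_p lt_ps]].
  exact/IHn/(leq_trans lt_ps).
by apply: IHs; rewrite sz_p ?eqxx.
Qed.

Lemma lexlt_trans : transitive lexlt.
Proof.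
move=> q p r; elim: p q r => [|x p IHp] [|y q] [|z r] //=.
case/orP=> [xy|/andP[/eqP-> pq]] /orP[yz|/andP[/eqP yz qr]].
- by rewrite (ltn_trans xy yz).
- by rewrite -yz xy.
- by rewrite yz.
- by rewrite yz eqxx (IHp q r) // orbT.
Qed.

(** Stopping in front of the first smaller letter makes this the
    lexicographically largest of all the insertions of [x] in [s]: at an earlier
    place [x] would push back a letter that is at least as large, and at a later
    one it would let the smaller letter pass before it. *)
Fixpoint ins x s : seq T :=
  match s with
  | [::] => [:: x]
  | y :: s' => if (key y < key x)%N then x :: s else y :: ins x s'
  end.

Lemma size_ins x s : size (ins x s) = (size s).+1.
Proof. by elim: s => //= y s IHs; case: ifP => //= _; rewrite IHs. Qed.

(** If one insertion stopped before the other, its word would go on after [x]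
    with a letter smaller than [x], but no word into which [x] has been inserted
    starts with such a letter. *)
Lemma ins_inj x : injective (ins x).
Proof.
elim=> [|y p IHp] [|z q] //=.
- by move/(congr1 size); case: ifP => //= _; rewrite size_ins.
- by move/(congr1 size); case: ifP => //= _; rewrite size_ins.
have aux u v w : (key v < key x)%N -> ins x u <> v :: w.
  case: u => [|u' u] /= ltvx; first by case=> eq_xv; rewrite eq_xv ltnn in ltvx.
  case: ltnP => [_ [eq_xv]|le_xu' [eq_wv]]; first by rewrite eq_xv ltnn in ltvx.
  by rewrite eq_wv leqNgt ltvx in le_xu'.
case: ltnP => [ltyx|leyx]; case: ltnP => [ltzx|lezx].
- by case=> -> ->.
- by case=> eq_xz /esym/aux; case.
- by case=> eq_xz /aux; case.
- by case=> -> /IHp ->.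
Qed.

(** The idea is that a letter that can be taken out remains so when another one
    is taken out. By symmetry [x] may be the smaller letter; then [y] is followed
    by nothing or by a letter smaller than [y], and if this letter is the
    inserted [x], by nothing or by a letter smaller still once [x] is gone. *)
Lemma ins_exchange x y p q : ins x p = ins y q -> x != y ->
  exists2 r, p = ins y r & q = ins x r.
Proof.
wlog lt_xy : x y p q / (key x < key y)%N.
  move=> hw eq_ins neq_xy; have: key x != key y by rewrite (inj_eq key_inj).
  rewrite neq_ltn => /orP[lt_xy|lt_yx]; first exact: hw eq_ins neq_xy.
  rewrite eq_sym in neq_xy.
  by have [r] := hw _ _ _ _ lt_yx (esym eq_ins) neq_xy; exists r.
move=> + _; elim: p q => [|a p IHp] [|b q] /=.
- by case=> eq_xy; rewrite eq_xy ltnn in lt_xy.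
- by move/(congr1 size); case: ifP => //= _; rewrite size_ins.
- by move/(congr1 size); case: ifP => //= _; rewrite size_ins.
case: ltnP => [lt_ax|le_xa]; case: ltnP => [lt_by|le_yb] /=.
- by case=> eq_xy; rewrite eq_xy ltnn in lt_xy.
- by case=> eq_xb; rewrite -eq_xb leqNgt lt_xy in le_yb.
- case=> -> eq_p; exists p; rewrite -?eq_p //.
  case: p eq_p {IHp} => //= c p.
  case: ifP => [lt_cx _|_ [-> _]]; last by rewrite lt_by.
  by rewrite (ltn_trans lt_cx lt_xy).
- case=> eq_ab /IHp[r -> ->]; exists (b :: r); rewrite /= ?eq_ab.
    by rewrite ltnNge le_yb.
  by rewrite ltnNge -eq_ab le_xa.
Qed.

Lemma cons_le_ins x s : x :: s = ins x s \/ lexlt (x :: s) (ins x s).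
Proof.
elim: s => [|y s IHs] /=; first by left.
case: ltnP => [_|]; first by left.
rewrite leq_eqVlt => /orP[/eqP/key_inj<-|lt_xy].
  by case: IHs => [<-|/= ->]; [left | right; rewrite eqxx orbT].
by right; rewrite /= lt_xy.
Qed.

(** The two insertions run alike up to the first letters a < b that distinguish
    [p] from [q]. They can separate there only if a < [x] <= b, and then [x] in
    front of a is compared with b; the case [x] = b is settled by
    [cons_le_ins]. *)
Lemma ins_lexlt x p q :
  size p = size q -> lexlt p q -> lexlt (ins x p) (ins x q).
Proof.
elim: p q => [|a p IHp] [|b q] //= [sz_pq] /orP[lt_ab|/andP[/eqP<- lt_pq]].
  case: (ltnP (key a)) => [lt_ax|le_xa].
    case: ltnP => /= [lt_bx|le_xb]; first by rewrite lt_ab eqxx orbT.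
    move: le_xb; rewrite leq_eqVlt => /orP[/eqP/key_inj<-|->//].
    rewrite eqxx ltnn /=.
    have [<-|] := cons_le_ins x q; first by rewrite /= lt_ax.
    apply: (@lexlt_trans (x :: q) (a :: p)); by rewrite /= lt_ax.
  by rewrite ltnNge (leq_trans le_xa (ltnW lt_ab)) /= lt_ab.
by case: ifP => /= _; rewrite ?eqxx /= ?lt_pq ?IHp ?orbT.
Qed.

Lemma ins_shortlex x p q : shortlex p q -> shortlex (ins x p) (ins x q).
Proof.
rewrite /shortlex !size_ins ltnS eqSS.
case/orP=> [->//|/andP[/eqP sz_pq lt_pq]].
by rewrite sz_pq eqxx ins_lexlt ?orbT.
Qed.

(** The ways to take one letter out, of which [unins] keeps the first one that
    an insertion undoes. *)
Fixpoint extractions s : seq (T * seq T) :=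
  if s is x :: s' then (x, s') :: [seq (c.1, x :: c.2) | c <- extractions s']
  else [::].

Definition unins s : option (T * seq T) :=
  ohead [seq c <- extractions s | ins c.1 c.2 == s].

Lemma mem_extractions_ins x s : (x, s) \in extractions (ins x s).
Proof.
elim: s => [|y s IHs] /=; first by rewrite inE.
case: ifP => _ /=; rewrite inE ?eqxx //; apply/orP; right.
by apply/mapP; exists (x, s).
Qed.

Lemma unins_some s x p : unins s = Some (x, p) -> ins x p = s.
Proof.
rewrite /unins; case E: (filter _ _) => [|c cs] //= [def_c].
have: c \in [seq c <- extractions s | ins c.1 c.2 == s] by rewrite E mem_head.
by rewrite mem_filter def_c => /andP[/eqP].
Qed.

Lemma unins_ins x p : unins (ins x p).
Proof.
rewrite /unins; set cs := filter _ _.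
have: (x, p) \in cs by rewrite mem_filter eqxx mem_extractions_ins.
by case: cs.
Qed.

End Words.

(** * Graftings and their leading term *)

Section Graft.
Variable D : choiceType.
Implicit Types (s t u v w : ptree D) (ts us vs ws : seq (ptree D)).

(** The induction principle generated for this nested type gives no hypothesis
    on the children. *)
Lemma ptree_nested_ind (P : ptree D -> Prop) :
  (forall d us, (forall u, u \in us -> P u) -> P (Bnode d us)) ->
  forall t, P t.
Proof.
move=> IH; fix self 1; case=> d us; apply: IH.
elim: us => [v|u us IHus v]; first by rewrite in_nil => v_in; discriminate v_in.
rewrite inE; case: eqP => [-> _|_]; [exact: self | exact: IHus].
Qed.

Fixpoint gforest t us : seq (seq (ptree D)) :=
  if us is v :: vs then
    (t :: v :: vs) :: [seq w :: vs | w <- graft t v]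
                   ++ [seq v :: ws | ws <- gforest t vs]
  else [:: [:: t]].

Lemma graft_node t d us : graft t (Bnode d us) = map (Bnode d) (gforest t us).
Proof. by rewrite /=; congr map; elim: us => //= v vs ->. Qed.

(* [lia] does not recognize a sum as an atom, so sums become variables. *)
Local Ltac generalize_sums :=
  repeat match goal with
  | |- context [@bigop.bigop.body ?R ?I ?x0 ?r ?F] =>
      generalize (@bigop.bigop.body R I x0 r F); intro
  end.

(** The graftings of [x] over the graftings of [y] over a forest, minus those
    that put [x] on [y], are the ways to graft [x] and [y] independently, and
    these do not depend on the order. Adding the graftings of < y ; x > instead
    of subtracting those of < x ; y > keeps the identity among natural numbers:
    [F] being arbitrary, it then says that two lists are permutations of each
    other. *)
Lemma gforest_prelie x y us (F : seq (ptree D) -> nat) :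
  (forall v, v \in us -> forall f : ptree D -> nat,
    (\sum_(w <- graft y v) \sum_(r <- graft x w) f r
      + \sum_(w <- graft y x) \sum_(r <- graft w v) f r
    = \sum_(w <- graft x v) \sum_(r <- graft y w) f r
      + \sum_(w <- graft x y) \sum_(r <- graft w v) f r)%N) ->
  (\sum_(ws <- gforest y us) \sum_(vs <- gforest x ws) F vs
      + \sum_(w <- graft y x) \sum_(vs <- gforest w us) F vs
  = \sum_(ws <- gforest x us) \sum_(vs <- gforest y ws) F vs
      + \sum_(w <- graft x y) \sum_(vs <- gforest w us) F vs)%N.
Proof.
elim: us F => [|v us IHus] F IHv.
  have expand (w : ptree D) t (G : seq (ptree D) -> nat) :
    (\sum_(ws <- gforest t [:: w]) G ws
     = G [:: t; w] + \sum_(r <- graft t w) G [:: r] + G [:: w; t])%N.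
    by rewrite big_cons big_cat !big_map big_seq1 addnA.
  have single ts : (\sum_(w <- ts) \sum_(vs <- gforest w [::]) F vs
      = \sum_(w <- ts) F [:: w])%N.
    by apply: eq_bigr => w _; rewrite big_seq1.
  by rewrite !single !big_seq1 !expand; generalize_sums; lia.
have expand (G : seq (ptree D) -> nat) t w ws :
  (\sum_(vs <- gforest t (w :: ws)) G vs
   = G [:: t, w & ws] + \sum_(r <- graft t w) G (r :: ws)
     + \sum_(vs <- gforest t ws) G (w :: vs))%N.
  by rewrite big_cons big_cat !big_map addnA.
have {}IHus := IHus (fun vs => F (v :: vs))
  (fun u u_in => IHv u (@mem_behead _ (v :: us) u u_in)).
have {}IHv := IHv v (mem_head v us) (fun r => F (r :: us)).
have expand2 (G : seq (ptree D) -> nat) ts vs :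
  (\sum_(w <- ts) \sum_(ws <- gforest w (v :: vs)) G ws
   = \sum_(w <- ts) G [:: w, v & vs]
     + \sum_(w <- ts) \sum_(r <- graft w v) G (r :: vs)
     + \sum_(w <- ts) \sum_(ws <- gforest w vs) G (v :: ws))%N.
  by rewrite -!big_split; apply: eq_bigr => w _; rewrite expand.
have expand3 (G : seq (ptree D) -> nat) t ts vs :
  (\sum_(w <- ts) \sum_(ws <- gforest t (w :: vs)) G ws
   = \sum_(w <- ts) G [:: t, w & vs]
     + \sum_(w <- ts) \sum_(r <- graft t w) G (r :: vs)
     + \sum_(w <- ts) \sum_(ws <- gforest t vs) G (w :: ws))%N.
  by rewrite -!big_split; apply: eq_bigr => w _; rewrite expand.
have expand4 (G : seq (ptree D) -> nat) t vss :
  (\sum_(vs <- vss) \sum_(ws <- gforest t (v :: vs)) G ws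
   = \sum_(vs <- vss) G [:: t, v & vs]
     + \sum_(vs <- vss) \sum_(r <- graft t v) G (r :: vs)
     + \sum_(vs <- vss) \sum_(ws <- gforest t vs) G (v :: ws))%N.
  by rewrite -!big_split; apply: eq_bigr => w _; rewrite expand.
rewrite !(expand (fun ws => \sum_(vs <- gforest _ ws) F vs)).
rewrite !expand !expand3 !expand4 !expand2.
have exch ts vss : (\sum_(vs <- vss) \sum_(w <- ts) F (w :: vs)
    = \sum_(w <- ts) \sum_(vs <- vss) F (w :: vs))%N.
  exact: exchange_big.
rewrite !exch; move: IHus IHv; generalize_sums; lia.
Qed.

Lemma graft_prelie x y z (f : ptree D -> nat) :
  (\sum_(w <- graft y z) \sum_(r <- graft x w) f r
      + \sum_(w <- graft y x) \sum_(r <- graft w z) f r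
    = \sum_(w <- graft x z) \sum_(r <- graft y w) f r
      + \sum_(w <- graft x y) \sum_(r <- graft w z) f r)%N.
Proof.
elim/ptree_nested_ind: z f => d us IH f.
have toforest s vss :
    (\sum_(w <- map (Bnode d) vss) \sum_(r <- graft s w) f r
     = \sum_(ws <- vss) \sum_(vs <- gforest s ws) f (Bnode d vs))%N.
  by rewrite big_map; apply: eq_bigr => ws _; rewrite graft_node big_map.
have toforest2 ts :
    (\sum_(w <- ts) \sum_(r <- graft w (Bnode d us)) f r
     = \sum_(w <- ts) \sum_(vs <- gforest w us) f (Bnode d vs))%N.
  by apply: eq_bigr => w _; rewrite graft_node big_map.
by rewrite !toforest2 !graft_node !toforest; apply: gforest_prelie.
Qed.

Fixpoint weight t : nat :=
  let: Bnode _ us := t in (sumn (map weight us)).+1.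

Lemma weight_gt0 t : (0 < weight t)%N.
Proof. by case: t. Qed.

Lemma weight_graft t u v :
  v \in graft t u -> weight v = (weight t + weight u)%N.
Proof.
elim/ptree_nested_ind: u v => d us IH v; rewrite graft_node.
case/mapP=> ws ws_in -> /=; rewrite addnS; congr _.+1.
elim: us ws ws_in IH => [|u us IHus] ws /=.
  by rewrite inE => /eqP-> _ /=.
rewrite inE mem_cat.
case/or3P=> [/eqP-> _ //|/mapP[w w_in ->] IH|/mapP[vs vs_in ->] IH] /=.
  by rewrite (IH u) ?mem_head // addnA.
rewrite (IHus vs) // => [|v' v'_in]; first by rewrite addnCA.
by apply: IH; rewrite inE v'_in orbT.
Qed.

Variable key : ptree D -> nat.
Hypothesis key_inj : injective key.

Lemma ins_in_gforest t us : ins key t us \in gforest t us.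
Proof.
elim: us => [|u us IHus] /=; first by rewrite inE.
case: ifP => _; rewrite inE ?eqxx // mem_cat.
by rewrite [X in _ || (_ || X)]map_f ?orbT.
Qed.

(** A grafting at the root inserts [t] among the children, and [ins] is the
    largest insertion; a grafting over a child leaves their number unchanged. *)
Lemma gforest_lead t us ws :
  ws \in gforest t us -> ws = ins key t us \/ shortlex key ws (ins key t us).
Proof.
elim: us ws => [|v us IHus] ws; first by rewrite inE => /eqP->; left.
rewrite inE mem_cat => /or3P[/eqP->|/mapP[w _ ->]|/mapP[vs vs_in ->]].
- have [<-|lt_ins] := cons_le_ins key_inj t (v :: us); first by left.
  by right; rewrite /shortlex size_ins eqxx lt_ins orbT.
- by right; rewrite /shortlex size_ins ltnSn.
have le_vs : (size vs <= (size us).+1)%N.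
  case: (IHus _ vs_in) => [->|]; first by rewrite size_ins.
  by rewrite /shortlex size_ins => /orP[/ltnW|/andP[/eqP->]].
rewrite /=; case: ltnP => [lt_vt|_].
  by right; rewrite /shortlex /= lt_vt orTb andbT orbC -leq_eqVlt.
case: (IHus _ vs_in) => [->|lt_vs]; first by left.
by right; rewrite /shortlex /= ltnS eqSS eqxx ltnn.
Qed.

Definition children t := let: Bnode _ us := t in us.

(** The leading term of the graftings of [s] over [u]; the name recalls the
    non-associative permutative law [nap s (nap t u) = nap t (nap s u)]. *)
Definition nap s u := let: Bnode d us := u in Bnode d (ins key s us).

Definition unnap t : option (ptree D * ptree D) :=
  let: Bnode d us := t in
  omap (fun c => (c.1, Bnode d c.2)) (unins key us).

(** The weight comes before the number of children because the recursion also
    descends to the factor [s] of [nap s u], whose root can have more children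
    than that of [nap s u]. *)
Definition tree_lt t u : bool :=
  (weight t < weight u)%N
  || (weight t == weight u) && shortlex key (children t) (children u).

Lemma tree_lt_wf : well_founded tree_lt.
Proof.
move=> t; have [n] := ubnP (weight t).
elim: n t => [|n IHn] t le_tn; [by [] |].
have [us] : {us | us = children t} by exists (children t).
elim/(well_founded_ind (@shortlex_wf _ key)): us t le_tn.
move=> us IHus t le_tn def_us.
constructor=> u /orP[lt_ut|/andP[/eqP eq_ut lt_ut]].
  exact/IHn/(leq_trans lt_ut).
by apply: (IHus (children u)); rewrite ?def_us ?eq_ut.
Qed.

Lemma nap_in_graft s u : nap s u \in graft s u.
Proof. by case: u => d us; rewrite graft_node; apply/map_f/ins_in_gforest. Qed.

Lemma weight_nap s u : weight (nap s u) = (weight s + weight u)%N.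
Proof. exact: weight_graft (nap_in_graft s u). Qed.

Lemma size_children_nap s u :
  size (children (nap s u)) = (size (children u)).+1.
Proof. by case: u => d us; rewrite /= size_ins. Qed.

Lemma graft_lead s u v : v \in graft s u -> v != nap s u -> tree_lt v (nap s u).
Proof.
move=> v_in; rewrite /tree_lt weight_nap (weight_graft v_in) eqxx.
case: u v_in => d us; rewrite graft_node => /mapP[ws ws_in ->] neq_ws.
case: (gforest_lead ws_in) neq_ws => [->|->]; first by rewrite eqxx.
by rewrite orbT.
Qed.

Lemma unnap_some t s u : unnap t = Some (s, u) -> nap s u = t.
Proof.
case: t => d us /=; case E: (unins _ _) => [[x p]|] //= [<- <-] /=.
by rewrite (unins_some E).
Qed.

Lemma unnap_nap s u : unnap (nap s u).
Proof. by case: u => d us /=; have := unins_ins key s us; case: unins. Qed.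

Lemma nap_inj s : injective (nap s).
Proof. by case=> d us [d' us'] [-> /(ins_inj)->]. Qed.

Lemma nap_exchange s s' u u' : nap s u = nap s' u' -> s != s' ->
  exists2 w, u = nap s' w & u' = nap s w.
Proof.
case: u u' => d us [d' us'] [-> eq_ins] neq_s.
have [ws -> ->] := ins_exchange key_inj eq_ins neq_s.
by exists (Bnode d' ws).
Qed.

Lemma tree_lt_nap s u u' : tree_lt u u' -> tree_lt (nap s u) (nap s u').
Proof.
rewrite /tree_lt !weight_nap ltn_add2l eqn_add2l.
case/orP=> [->//|/andP[/eqP-> lt_uu']]; rewrite eqxx ltnn /=.
by case: u u' lt_uu' => d us [d' us']; apply: ins_shortlex.
Qed.

Lemma tree_lt_napl s u : tree_lt s (nap s u).
Proof.
by rewrite /tree_lt weight_nap -{1}[weight s]addn0 ltn_add2l weight_gt0.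
Qed.

Lemma tree_lt_napr s u : tree_lt u (nap s u).
Proof.
by rewrite /tree_lt weight_nap -{1}[weight u]add0n ltn_add2r weight_gt0.
Qed.

(** In the pre-Lie identity the terms where the first two factors are multiplied
    together have a root with one child less. *)
Lemma tree_lt_nap_graft s s' r w :
  r \in graft s s' -> tree_lt (nap r w) (nap s (nap s' w)).
Proof.
move=> /weight_graft weight_r; rewrite /tree_lt !weight_nap weight_r addnA eqxx.
by rewrite /shortlex !size_children_nap ltnS ltnSn orbT.
Qed.

End Graft.

(** * Linear maps on a space with a basis *)

Section LinearExtensionality.
Variables (K : fieldType) (T : choiceType).
Implicit Types (V : lmodType K) (r : seq T).

Lemma linear_sum_seq (U V : lmodType K) (F : U -> V) : linear F ->
  forall (I : Type) (r : seq I) (f : I -> U),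
    F (\sum_(i <- r) f i) = \sum_(i <- r) F (f i).
Proof.
move=> linF I r f.
pose Fl : {linear U -> V} := HB.pack F (GRing.isLinear.Build K U V *:%R F linF).
exact: (linear_sum Fl).
Qed.

Lemma linear_scale (U V : lmodType K) (F : U -> V) : linear F ->
  forall a x, F (a *: x) = a *: F x.
Proof.
move=> linF a x.
pose Fl : {linear U -> V} := HB.pack F (GRing.isLinear.Build K U V *:%R F linF).
exact: (linearZ_LR Fl).
Qed.

Lemma malg_linear_eq0 V (F : {malg K[T]} -> V) : linear F ->
  (forall t, F << t >> = 0) -> forall x, F x = 0.
Proof.
move=> linF F0 x; rewrite (monalgE x) (linear_sum_seq linF) big1 // => t _.
have -> : << x@_t *g t >> = x@_t *: << t >> :> {malg K[T]}.
  by apply/malgP=> u; rewrite mcoeffZ !mcoeffU mulrnAr mulr1.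
by rewrite (linear_scale linF) F0 scaler0.
Qed.

Lemma linear_subf (U V : lmodType K) (F G : U -> V) :
  linear F -> linear G -> linear (fun x => F x - G x).
Proof. by move=> lF lG a u v; rewrite lF lG scalerBr opprD addrACA. Qed.

Lemma linear_comp (U V W : lmodType K) (F : V -> W) (G : U -> V) :
  linear F -> linear G -> linear (fun x => F (G x)).
Proof. by move=> lF lG a u v; rewrite lG lF. Qed.

Lemma sum_count (V : nmodType) (f : T -> V) r t :
  \sum_(v <- r) f v = f t *+ count_mem t r + \sum_(v <- r | v != t) f v.
Proof.
elim: r => [|v r IHr]; first by rewrite !big_nil addr0.
rewrite !big_cons IHr /=; case: eqP => [->|_] /=; last by rewrite add0n addrCA.
by rewrite mulrS addrA.
Qed.

End LinearExtensionality.

(** * Pre-Lie products *)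

Section PreLieMultiplicativity.
Variable K : fieldType.

Lemma prelie_swap (A : lmodType K) (opA : A -> A -> A) : is_prelie opA ->
  forall x y z,
    opA x (opA y z) = opA (opA x y) z - opA (opA y x) z + opA y (opA x z).
Proof.
case=> _ _ prelie x y z; rewrite addrAC -addrA -opprB -prelie opprB.
by rewrite addrC subrK.
Qed.

(** The pre-Lie identity transports multiplicativity from the pair (y, x z) to
    the pair (x, y z), if the correcting terms are multiplicative. *)
Lemma multiplicative_swap (A B : lmodType K) (opA : A -> A -> A)
    (opB : B -> B -> B) (phi : A -> B) :
  is_prelie opA -> is_prelie opB -> linear phi ->
  let mult x y := phi (opA x y) = opB (phi x) (phi y) in
  forall x y z, mult x y -> mult y x -> mult x z -> mult y z ->
    mult y (opA x z) -> mult (opA x y) z -> mult (opA y x) z ->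
  mult x (opA y z).
Proof.
move=> prelieA prelieB lin_phi mult x y z; rewrite /mult.
move=> xy yx xz yz y_xz xy_z yx_z.
pose phil : {linear A -> B} :=
  HB.pack phi (GRing.isLinear.Build K A B *:%R phi lin_phi).
rewrite (prelie_swap prelieA) -[phi (_ + _)]/(phil (_ + _)) linearD linearB /=.
by rewrite xy_z yx_z y_xz xy yx xz yz -(prelie_swap prelieB).
Qed.

End PreLieMultiplicativity.

Section BracePreLie.
Variables (K : fieldType) (D : choiceType).
Local Notation brace := (@brace K D).

Lemma brace_prelie : is_prelie brace.
Proof.
split=> [y|x|]; [exact: brace_linearl | exact: brace_linearr |].
pose assoc (x y z : Br K D) := brace (brace x y) z - brace x (brace y z).
have bl y := @brace_linearl K D y.
have br x := @brace_linearr K D x.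
suff main x y z : assoc x y z - assoc y x z = 0.
  by move=> x y z; apply/eqP; rewrite -subr_eq0; apply/eqP/main.
have lin1 y' z' : linear (fun x' => assoc x' y' z').
  by apply: linear_subf => //; apply: linear_comp (bl z') (bl y').
have lin2 x' z' : linear (fun y' => assoc x' y' z').
  apply: linear_subf; first exact: linear_comp (bl z') (br x').
  exact: linear_comp (br x') (bl z').
have lin3 x' y' : linear (fun z' => assoc x' y' z').
  by apply: linear_subf => //; apply: linear_comp (br x') (br y').
move: x; apply: malg_linear_eq0 => [|s]; first exact: linear_subf.
move: y; apply: malg_linear_eq0 => [|t]; first exact: linear_subf.
move: z; apply: malg_linear_eq0 => [|u]; first exact: linear_subf.
rewrite /assoc !brace_basis.
have sumr a r : brace << a >> (\sum_(v <- r) << v >>)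
    = \sum_(v <- r) \sum_(w <- graft a v) << w >>.
  rewrite (linear_sum_seq (br _)).
  by apply: eq_bigr => v _; rewrite brace_basis.
have suml a r : brace (\sum_(v <- r) << v >>) << a >>
    = \sum_(v <- r) \sum_(w <- graft v a) << w >>.
  rewrite (linear_sum_seq (bl _)).
  by apply: eq_bigr => v _; rewrite brace_basis.
rewrite !sumr !suml.
rewrite opprB addrACA -opprD [X in X - _]addrC.
apply/eqP; rewrite subr_eq0 eq_sym; apply/eqP.
(* The two sides enumerate the same trees, in different orders. *)
pose list (x y z : ptree D) :=
  flatten [seq graft x w | w <- graft y z]
  ++ flatten [seq graft w z | w <- graft y x].
have sum_list (V : nmodType) (f : ptree D -> V) x y z :
    \sum_(v <- list x y z) f v = \sum_(w <- graft y z) \sum_(v <- graft x w) f v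
      + \sum_(w <- graft y x) \sum_(v <- graft w z) f v.
  by rewrite big_cat !big_flatten !big_map.
have perm_list : perm_eq (list s t u) (list t s u).
  apply/permP=> p; rewrite -!sum1_count !(big_mkcond p).
  rewrite (sum_list nat (fun v => if p v then 1%N else 0%N)).
  rewrite (sum_list nat (fun v => if p v then 1%N else 0%N)).
  exact: graft_prelie.
by rewrite -!sum_list; apply: perm_big.
Qed.

End BracePreLie.

(** * The universal property *)

Section FreeExtension.
Variables (K : fieldType) (D : choiceType).
Hypothesis charK0 : [pchar K]%R =i pred0.
Variable key : ptree D -> nat.
Hypothesis key_inj : injective key.
Local Notation brace := (@brace K D).
Local Notation nap := (nap key).
Local Notation unnap := (unnap key).
Local Notation tree_lt := (tree_lt key).
Implicit Types s t u v w : ptree D.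

Lemma leading_coef_neq0 s u : (count_mem (nap s u) (graft s u))%:R != 0 :> K.
Proof.
by rewrite (pcharf0P K).1 // -lt0n -has_count has_pred1 nap_in_graft.
Qed.

(** As the leading coefficient is invertible, a linear map that kills
    < s ; u > and its lower terms kills its leading term. *)
Lemma leading_eq0 (V : lmodType K) (F : Br K D -> V) s u : linear F ->
    F (brace << s >> << u >>) = 0 ->
    (forall v, v \in graft s u -> tree_lt v (nap s u) -> F << v >> = 0) ->
  F << nap s u >> = 0.
Proof.
move=> linF; rewrite brace_basis (linear_sum_seq linF) => F_su F_lt.
move: F_su; rewrite (sum_count _ _ (nap s u)) big_seq_cond.
rewrite big1 => [|v /andP[v_in neq_v]].
  rewrite addr0 -scaler_nat => /eqP; rewrite scaler_eq0.
  by rewrite (negPf (leading_coef_neq0 s u)) => /eqP.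
exact/F_lt/(graft_lead key_inj v_in neq_v).
Qed.

Definition generator : Type := {t : ptree D | ~~ unnap t}.

Variables (B : lmodType K) (op : B -> B -> B).
Hypothesis opP : is_prelie op.
Variable f : generator -> B.

(** A total function in place of one on the trees smaller than [t], so that it
    can be summed; the default value 0 is never reached, as all trees that occur
    in the recursion are smaller. *)
Definition totalize t (rec : forall v, tree_lt v t -> B) v : B :=
  if (insub v : option {w | tree_lt w t}) is Some w then rec (val w) (valP w)
  else 0.

Lemma totalizeE (g : ptree D -> B) t v :
  tree_lt v t -> @totalize t (fun w _ => g w) v = g v.
Proof. by move=> lt_vt; rewrite /totalize insubT. Qed.

(** For a tree with chosen factorization (s, u) the value is the solution of
    ext < s ; u > = op (ext s) (ext u), an equation that is linear in the value
    at the leading term. *)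
Definition ext_body t (rec : forall v, tree_lt v t -> B) : B :=
  let g := totalize rec in
  if insub t is Some x then f x else
  if unnap t is Some (s, u) then
    (count_mem t (graft s u))%:R^-1
      *: (op (g s) (g u) - \sum_(v <- graft s u | v != t) g v)
  else 0.

Definition ext_basis : ptree D -> B :=
  Fix (tree_lt_wf key) (fun=> B) ext_body.

Lemma ext_basisE t : ext_basis t = @ext_body t (fun v _ => ext_basis v).
Proof.
apply: (Fix_eq (tree_lt_wf key) (fun=> B)) => {}t g h eq_gh; rewrite /ext_body.
case: insubP => // _; case: unnap => // -[s u].
have eq_rec v : totalize g v = totalize h v.
  by rewrite /totalize; case: insub.
rewrite !eq_rec; congr (_ *: (_ - _)); exact: eq_bigr.
Qed.

Lemma ext_basis_generator (x : generator) : ext_basis (val x) = f x.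
Proof. by rewrite ext_basisE /ext_body valK. Qed.

Lemma ext_basis_unnap t s u : unnap t = Some (s, u) ->
  \sum_(v <- graft s u) ext_basis v = op (ext_basis s) (ext_basis u).
Proof.
move=> unnap_t; have def_t := unnap_some unnap_t.
rewrite (sum_count _ _ t) [ext_basis t]ext_basisE /ext_body insubN ?unnap_t //.
have lt_st : tree_lt s t by rewrite -def_t tree_lt_napl.
have lt_ut : tree_lt u t by rewrite -def_t tree_lt_napr.
rewrite !totalizeE // -scaler_nat scalerA mulfV ?scale1r; last first.
  by rewrite -def_t leading_coef_neq0.
rewrite [X in _ - X + _](_ : _ = \sum_(v <- graft s u | v != t) ext_basis v);
  first by rewrite subrK.
rewrite big_seq_cond [RHS]big_seq_cond; apply: eq_bigr => v /andP[v_in neq_vt].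
by apply: totalizeE; rewrite -def_t graft_lead ?def_t.
Qed.

Definition ext : Br K D -> B := malg_lift ext_basis.

Lemma ext_linear : linear ext.
Proof. exact: malg_lift_linear. Qed.

Lemma extE t : ext << t >> = ext_basis t.
Proof. exact: malg_lift_basis. Qed.

Let multiplicative x y := ext (brace x y) = op (ext x) (ext y).

(** Measuring the failure of multiplicativity by a linear map lets
    [leading_eq0] and extension from the basis apply to it. *)
Lemma linear_multr x : linear (fun y => ext (brace x y) - op (ext x) (ext y)).
Proof.
case: opP => _ opr _; apply: linear_subf.
  exact: linear_comp ext_linear (brace_linearr x).
exact: linear_comp (opr _) ext_linear.
Qed.

Lemma linear_multl y : linear (fun x => ext (brace x y) - op (ext x) (ext y)).
Proof.
case: opP => opl _ _; apply: linear_subf.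
  exact: linear_comp ext_linear (brace_linearl y).
exact: linear_comp (opl _) ext_linear.
Qed.

Lemma multiplicative_sumr x r :
  (forall v, v \in r -> multiplicative x << v >>) ->
  multiplicative x (\sum_(v <- r) << v >>).
Proof.
move=> mult_r; apply/eqP; rewrite -subr_eq0 (linear_sum_seq (linear_multr x)).
by rewrite big_seq big1 // => v /mult_r->; rewrite subrr.
Qed.

Lemma multiplicative_suml r y :
  (forall v, v \in r -> multiplicative << v >> y) ->
  multiplicative (\sum_(v <- r) << v >>) y.
Proof.
move=> mult_r; apply/eqP; rewrite -subr_eq0 (linear_sum_seq (linear_multl y)).
by rewrite big_seq big1 // => v /mult_r->; rewrite subrr.
Qed.

(** Two factorizations of the same leading term differ by an exchange, so the
    pre-Lie identity carries multiplicativity over from the chosen one. *)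
Lemma ext_brace_basis s u : multiplicative << s >> << u >>.
Proof.
have [t def_t] : exists t, nap s u = t by exists (nap s u).
elim/(well_founded_ind (@tree_lt_wf D key)): t s u def_t => t IH s u def_t.
have := unnap_nap key s u; rewrite def_t.
case unnap_t: (unnap t) => [[s' u']|] // _.
have mult' : multiplicative << s' >> << u' >>.
  rewrite /multiplicative brace_basis (linear_sum_seq ext_linear).
  by under eq_bigr do rewrite extE; rewrite (ext_basis_unnap unnap_t) !extE.
have def_t' := unnap_some unnap_t.
have [eq_s|neq_s] := eqVneq s s'.
  move: def_t; rewrite eq_s -def_t' => /nap_inj->; exact: mult'.
have eq_nap : nap s u = nap s' u' by rewrite def_t def_t'.
have [w def_u def_u'] := nap_exchange key_inj eq_nap neq_s.
have mult_lt a b : tree_lt (nap a b) t -> multiplicative << a >> << b >>.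
  by move=> /IH; apply.
(* [u] is the leading term of < s' ; w >, so that the pair (s, u) can be traded
   for (s, < s' ; w >). *)
apply/eqP; rewrite -subr_eq0 def_u; apply/eqP.
apply: (leading_eq0 (linear_multr << s >>)); last first.
  move=> v _ lt_v; apply/eqP; rewrite subr_eq0; apply/eqP/mult_lt.
  by rewrite -def_t def_u tree_lt_nap.
have [lt_su lt_su'] : tree_lt (nap s s') t /\ tree_lt (nap s' s) t.
  by rewrite -{1}def_t -def_t' def_u def_u' !tree_lt_nap ?tree_lt_napl.
have mult_sw : multiplicative << s >> << w >>.
  by apply: mult_lt; rewrite -def_u' -def_t' tree_lt_napr.
have mult_s'w : multiplicative << s' >> << w >>.
  by apply: mult_lt; rewrite -def_u -def_t tree_lt_napr.
have mult_s'_sw : multiplicative << s' >> (brace << s >> << w >>).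
  rewrite brace_basis; apply: multiplicative_sumr => v v_in.
  have [->|neq_v] := eqVneq v u'; first exact: mult'.
  apply: mult_lt; rewrite -def_t' tree_lt_nap // def_u' graft_lead //.
  by rewrite -def_u'.
have mult_ss'_w : multiplicative (brace << s >> << s' >>) << w >>.
  rewrite brace_basis; apply: multiplicative_suml => r r_in.
  by apply: mult_lt; rewrite -def_t def_u tree_lt_nap_graft.
have mult_s's_w : multiplicative (brace << s' >> << s >>) << w >>.
  rewrite brace_basis; apply: multiplicative_suml => r r_in.
  by apply: mult_lt; rewrite -def_t' def_u' tree_lt_nap_graft.
apply/eqP; rewrite subr_eq0; apply/eqP.
exact: (multiplicative_swap (brace_prelie K D) opP ext_linear
  (mult_lt _ _ lt_su) (mult_lt _ _ lt_su') mult_sw mult_s'w mult_s'_sw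
  mult_ss'_w mult_s's_w).
Qed.

Lemma ext_brace x y : ext (brace x y) = op (ext x) (ext y).
Proof.
apply/eqP; rewrite -subr_eq0; apply/eqP; move: x.
apply: malg_linear_eq0 => [|s]; first exact: linear_multl.
move: y; apply: malg_linear_eq0 => [|u]; first exact: linear_multr.
by rewrite ext_brace_basis subrr.
Qed.

Lemma ext_unique (psi : Br K D -> B) : linear psi ->
    (forall x y, psi (brace x y) = op (psi x) (psi y)) ->
    (forall x : generator, psi << val x >> = f x) ->
  psi =1 ext.
Proof.
move=> lin_psi psi_brace psi_gen x; apply/eqP; rewrite -subr_eq0; apply/eqP.
have lin_diff : linear (fun x => psi x - ext x).
  exact: linear_subf lin_psi ext_linear.
apply: (malg_linear_eq0 lin_diff) => {x} t.
elim/(well_founded_ind (@tree_lt_wf D key)): t => t IH.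
case unnap_t: (unnap t) => [[s u]|]; last first.
  have gen_t : ~~ unnap t by rewrite unnap_t.
  have [x ->] : exists x : generator, t = val x by exists (exist _ t gen_t).
  by apply/eqP; rewrite subr_eq0 psi_gen extE ext_basis_generator.
rewrite -(unnap_some unnap_t) in IH *.
apply: (leading_eq0 lin_diff) => [|v _]; last exact: IH.
have eq_lt v : tree_lt v (nap s u) -> psi << v >> = ext << v >>.
  by move=> /IH/eqP; rewrite subr_eq0 => /eqP.
by rewrite psi_brace ext_brace !eq_lt ?tree_lt_napl ?tree_lt_napr ?subrr.
Qed.

End FreeExtension.

(** The order on trees comes from a numbering, on which the set of generators
    depends. *)
Lemma brace_free (K : fieldType) (charK0 : [pchar K]%R =i pred0)
    (D : choiceType) (key : ptree D -> nat) (key_inj : injective key) :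
  is_free_prelie_on (@brace K D)
    (fun x : generator key => << val x >> : Br K D).
Proof.
split; first exact: brace_prelie.
move=> B op opP f.
pose phi : {linear Br K D -> B} := HB.pack (ext op f)
  (GRing.isLinear.Build K _ B *:%R (ext op f) (ext_linear op f)).
exists phi; split=> [x y|x|psi psi_brace psi_gen].
- exact: ext_brace.
- by rewrite /= extE ext_basis_generator.
- by apply: ext_unique => //; exact: linearP.
Qed.

Theorem theorem10 (K : fieldType) (charK0 : [pchar K]%R =i pred0)
    (D : finType) :
  is_free_prelie (@brace K D).
Proof.
(* As [D] is countable, so are the trees. *)
pose key (t : ptree D) := choice.pickle (ptree_encode t).
have key_inj : injective key.
  exact: inj_comp (pcan_inj choice.pickleK) (pcan_inj (@ptree_encodeK D)).
by exists (generator key), (fun x => << val x >>); apply: brace_free.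
Qed.
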